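(* Let $\lambda\in\mathbb{R}^+$ and let $G$ be a 5-dimensional Riemannian Lie group with Lie algebra $\mathfrak{g}$, carrying a left-invariant, minimal and conformal distribution $\mathcal{V}$ generated by the Riemannian subalgebra $\mathfrak{su}(2)$ of $\mathfrak{g}$, i.e. $\mathcal V=\mathrm{span}\{X,Y,Z\}$ where $\{X,Y,Z,A,B\}$ is an adapted orthonormal basis of $\mathfrak g$ (see context) and $$[X,Y]=2\lambda Z,\quad [Z,X]=2\lambda Y,\quad [Y,Z]=\tfrac{2}{\lambda}X .$$ Then the Lie bracket relations of $\mathfrak g$ are of the form $$[X,Y]=2\lambda Z,\quad [Z,X]=2\lambda Y,\quad [Y,Z]=\tfrac{2}{\lambda}X,$$ \begin{align*} [X,A]&=-\lambda^2x_3Y-\lambda^2x_5Z, & [X,B]&=-\lambda^2x_4Y-\lambda^2x_6Z,\\ [Y,A]&=x_3X+z_3Z, & [Y,B]&=x_4X+z_4Z,\\ [Z,A]&=x_5X-z_3Y, & [Z,B]&=x_6X-z_4Y,\\ [A,B]&=rA+\theta_1X+\theta_2Y+\theta_3Z, \end{align*} with $r,x_3,x_4,x_5,x_6,z_3,z_4\in\mathbb R$, where $\theta_1,\theta_2,\theta_3$ are given by $$\begin{pmatrix}\theta_1\\ \theta_2\\ \theta_3\end{pmatrix}=\frac12\begin{pmatrix} rz_3/\lambda+\lambda(x_3x_6-x_4x_5)\\ \lambda(rx_5-x_3z_4+x_4z_3)\\ -\lambda(rx_3+z_4x_5-z_3x_6)\end{pmatrix}.$$ The corresponding foliation $\mathcal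 F$ tangent to $\mathcal V$ is Riemannian. It is totally geodesic if and only if $\lambda=1$, i.e. the leaves are 3-dimensional round spheres.
   Context: A Riemannian Lie group is a Lie group $G$ equipped with a left-invariant Riemannian metric $g=\langle\cdot,\cdot\rangle$; this is an inner product on its Lie algebra $\mathfrak g$. A left-invariant distribution $\mathcal V$ is identified with a subspace of $\mathfrak g$; it is integrable iff this subspace is a subalgebra $\mathfrak k$. $\mathcal H=\mathcal V^\perp$ is the orthogonal complement; $\mathcal V,\mathcal H$ also denote the orthogonal projections; $\nabla$ is the Levi-Civita connection. Set $B^{\mathcal V}(U,V)=\frac12\mathcal H(\nabla_UV+\nabla_VU)$ for $U,V\in\mathcal V$ and $B^{\mathcal H}(E,F)=\frac12\mathcal V(\nabla_EF+\nabla_FE)$ for $E,F\in\mathcal H$. The integrable distribution $\mathcal V$ (equivalently the foliation $\mathcal F$ tangent to it) is conformal if there is a vector field $V\in\mathcal V$ with $B^{\mathcal H}=g\otimes V$; Riemannian if this holds with $V=0$; minimal if $\mathrm{trace}\,B^{\mathcal V}=0$; totally geodesic if $B^{\mathcal V}=0$. Adapted orthonormal basis: $\mathcal V$ is a 3-dimensional integrable, conformal, minimal left-invariant distribution on the 5-dimensional $G$, $\{X,Y,Z,A,B\}$ is an orthonormal basis of $\mathfrak g$ with $\mathcal V=\mathrm{span}\{X,Y,Z\}$ and $\mathcal H=\mathrm{span}\{A,B\}$, and $A,B$ are chosen (as is always possible) such that the $\mathcal H$-component of $[A,B]$ is a multiple of $A$, that is, $[A,B]=rA+\theta_1X+\theta_2Y+\theta_3Z$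 with real constants.
   Formalization: ''Totally geodesic iff λ=1'' fails for one G with x3=x4=x5=x6=0 (e.g. SU(2)×R², λ≠1); proved instead: each G is totally geodesic iff λ=1 or x3=x4=x5=x6=0, and all G with given λ are iff λ=1. Round leaves means constant positive sectional curvature. *)

(* Defs.v *)
From HB Require Import structures.
From mathcomp Require Import all_boot all_order all_algebra.
From mathcomp Require Import reals.

Set Implicit Arguments.
Unset Strict Implicit.
Unset Printing Implicit Defensive.

Import Order.TTheory GRing.Theory Num.Theory.
Local Open Scope ring_scope.

(* A Lie group with a left-invariant Riemannian metric is represented by its
   Lie algebra with the induced inner product.  Every notion below is
   left-invariant, so it is determined by its values on left-invariant vector
   fields, that is, on elements of the Lie algebra. *)
Record riemLieAlgebra (R : realType) := RiemLieAlgebra {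
  rla_space :> vectType R;
  lie : {bilinear rla_space -> rla_space -> rla_space};
  metric : {dot rla_space for idfun};
  lie_alt : forall x, lie x x = 0;
  lie_jacobi : forall x y z,
    lie x (lie y z) + lie y (lie z x) + lie z (lie x y) = 0
}.

Arguments lie {R r}.
Arguments metric {R r}.

Declare Scope lie_scope.
Delimit Scope lie_scope with lie.
Notation "⟦ x , y ⟧" := (lie x y)
  (at level 0, x at level 99, y at level 99, format "⟦ x ,  y ⟧") : lie_scope.
Notation "⟨ x , y ⟩" := (metric x y)
  (at level 0, x at level 99, y at level 99, format "⟨ x ,  y ⟩") : lie_scope.
Local Open Scope lie_scope.

Section Connection.
Variables (R : realType) (G : riemLieAlgebra R).
Implicit Type D : {bilinear G -> G -> G}.

(* [D U W] stands for nabla_U W.  For left-invariant fields <U, W> is a constant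
   function, so its derivative does not appear in metric compatibility. *)
Definition levi_civita D : Prop :=
  (forall U W, D U W - D W U = ⟦U, W⟧) /\
  (forall T U W, ⟨D T U, W⟩ + ⟨U, D T W⟩ = 0).

Definition curvature D (T U W : G) : G :=
  D T (D U W) - D U (D T W) - D ⟦T, U⟧ W.

Definition constant_sectional_curvature (kappa : R) : Prop :=
  exists2 D, levi_civita D &
    forall U W, ⟨curvature D U W W, U⟩
                = kappa * (⟨U, U⟩ * ⟨W, W⟩ - ⟨U, W⟩ ^+ 2).

End Connection.

Section Distribution.
Variables (R : realType) (G : riemLieAlgebra R).
Implicit Types (D : {bilinear G -> G -> G}) (V : {vspace G}).

Definition integrable V : Prop :=
  {in V &, forall U W, ⟦U, W⟧ \in V}.

Definition horizontal V : {vspace G} := orthov metric V.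
Definition projV V : G -> G := daddv_pi V (horizontal V).
Definition projH V : G -> G := daddv_pi (horizontal V) V.

Definition BV D V (U W : G) : G := 2^-1 *: projH V (D U W + D W U).
Definition BH D V (E F : G) : G := 2^-1 *: projV V (D E F + D F E).

Definition BH_metric_tensor D V (N : G) : Prop :=
  {in horizontal V &, forall E F, BH D V E F = ⟨E, F⟩ *: N}.

(* B^H is left-invariant, so the vector field of the definition is too. *)
Definition conformal D V : Prop := exists2 N, N \in V & BH_metric_tensor D V N.

Definition riemannian D V : Prop := BH_metric_tensor D V 0.

(* The trace does not depend on the orthonormal basis e. *)
Definition minimal D V : Prop :=
  exists2 e : (\dim V).-tuple G, orthonormal metric e && basis_of V e &
    \sum_(U <- e) BV D V U U = 0.

Definition totally_geodesic D V : Prop :=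
  {in V &, forall U W, BV D V U W = 0}.

End Distribution.

(* An integral leaf through the identity is itself a Lie group with a
   left-invariant metric: the subalgebra V with the restricted bracket and
   inner product. *)
Section Leaf.
Variables (R : realType) (G : riemLieAlgebra R) (V : {vspace G}).

Definition leaf_lie (u w : subvs_of V) : subvs_of V :=
  vsproj V ⟦vsval u, vsval w⟧.
Definition leaf_metric (u w : subvs_of V) : R := ⟨vsval u, vsval w⟩.

Fact leaf_lie_bilinear : bilinear_for *:%R *:%R leaf_lie.
Proof.
split=> u a v w; rewrite /leaf_lie /=.
  by rewrite linearPl linearP.
by rewrite linearPr linearP.
Qed.
HB.instance Definition _ :=
  bilinear_isBilinear.Build R _ _ _ _ _ leaf_lie leaf_lie_bilinear.

Fact leaf_metric_bilinear : bilinear_for *%R (idfun \; *%R) leaf_metric.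
Proof.
split=> u a v w; rewrite /leaf_metric /=.
  by rewrite linearPl.
by rewrite linearPr.
Qed.
HB.instance Definition _ :=
  bilinear_isBilinear.Build R _ _ _ _ _ leaf_metric leaf_metric_bilinear.

Fact leaf_metric_sym u w : leaf_metric u w = (-1) ^+ false * idfun (leaf_metric w u).
Proof. exact: hermC. Qed.
HB.instance Definition _ :=
  isHermitianSesquilinear.Build R _ false idfun leaf_metric leaf_metric_sym.

Fact leaf_metric_gt0 u : u != 0 -> 0 < leaf_metric u u.
Proof.
by move=> u0; apply: neq0_dnorm_gt0; apply: contra u0 => /eqP u0; apply/eqP/val_inj.
Qed.
HB.instance Definition _ :=
  isDotProduct.Build R _ leaf_metric leaf_metric_gt0.

Hypothesis intV : integrable V.

Fact leaf_lie_alt x : leaf_lie x x = 0.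
Proof. by rewrite /leaf_lie lie_alt linear0. Qed.

Fact leaf_lie_jacobi x y z :
  leaf_lie x (leaf_lie y z) + leaf_lie y (leaf_lie z x)
  + leaf_lie z (leaf_lie x y) = 0.
Proof.
have E u w : vsval (leaf_lie u w) = ⟦vsval u, vsval w⟧.
  by rewrite vsprojK// intV// subvsP.
by apply: val_inj => /=; rewrite !E lie_jacobi.
Qed.

Definition leaf : riemLieAlgebra R :=
  @RiemLieAlgebra R (subvs_of V) leaf_lie leaf_metric
    leaf_lie_alt leaf_lie_jacobi.

End Leaf.

(* The leaves are homogeneous, hence complete, so they are round (spherical
   space forms) iff their sectional curvature is a positive constant. *)
Definition round_leaves (R : realType) (G : riemLieAlgebra R) (V : {vspace G}) :=
  exists intV : integrable V,
    exists2 kappa : R, 0 < kappa & constant_sectional_curvature (leaf intV) kappa.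

Section AdaptedBasis.
Variables (R : realType) (G : riemLieAlgebra R).

Record adapted_basis (D : {bilinear G -> G -> G}) (X Y Z A B : G) : Prop :=
  AdaptedBasis {
  adapted_dim : \dim {:G} = 5%N;
  adapted_levi_civita : levi_civita D;
  adapted_basis_of : basis_of fullv [:: X; Y; Z; A; B];
  adapted_orthonormal : orthonormal metric [:: X; Y; Z; A; B];
  adapted_integrable : integrable <<[:: X; Y; Z]>>%VS;
  adapted_conformal : conformal D <<[:: X; Y; Z]>>%VS;
  adapted_minimal : minimal D <<[:: X; Y; Z]>>%VS;
  adapted_lieAB : exists r theta1 theta2 theta3 : R,
    ⟦A, B⟧ = r *: A + theta1 *: X + theta2 *: Y + theta3 *: Z
}.

Definition su2_relations (lambda : R) (X Y Z : G) : Prop :=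
  [/\ ⟦X, Y⟧ = (2 * lambda) *: Z,
      ⟦Z, X⟧ = (2 * lambda) *: Y &
      ⟦Y, Z⟧ = (2 / lambda) *: X].

End AdaptedBasis.

(* Main.v *)
Require Import Defs.
From HB Require Import structures.
From mathcomp Require Import all_boot all_order all_algebra.
From mathcomp Require Import reals ring lra.

Set Implicit Arguments.
Unset Strict Implicit.
Unset Printing Implicit Defensive.

Import Order.TTheory GRing.Theory Num.Theory.
Local Open Scope ring_scope.
Local Open Scope lie_scope.

(** Write V for the span of X, Y, Z and H for its orthogonal complement. The
symmetrised Koszul formula [koszul_sym] turns every assumption on the
distribution into an assumption on the bracket: conformality says that each
t in V acts on g / V, identified with H, by a multiple of the identity plus a
skew map, and total geodesy says that each e in H acts on V by a skew map.

Since H is a plane, the maps that conformality allows commute with each other.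
The action of V on g / V is a representation, so brackets of elements of V act
trivially, and su(2) is spanned by such brackets. Thus V acts trivially
([action_trivial]), which means that [V, H] is contained in V. This already
makes the foliation Riemannian. It also means that A and B act on V by
derivations of su(2). Those are inner, and depend on three parameters each
([su2_derivation]): this is the announced form of the brackets. Because su(2)
has no centre, the Jacobi identity for A, B and an element of V then determines
the vertical part of [A, B] ([theta_jacobi]).

The inner derivations of su(2) are skew for the Killing form, which is
proportional to the metric exactly when lambda = 1. Comparing the two forms
gives the criterion for total geodesy ([totally_geodesic_cases]). The leaves
are Berger spheres, with sectional curvatures lambda^-2 and 4 - 3 lambda^-2 on
two of the coordinate planes, so they are round exactly when lambda = 1
([berger_round]).

For the family as a whole to be totally geodesic, lambda = 1 is necessary since
for every lambda there is a group in the family on which A acts by a derivation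
that moves X ([twisted_su2]); its Levi-Civita connection is given by the Koszul
formula ([levi_civita_exists]). *)

(** * Calculus in a metric Lie algebra *)

Section MetricLieAlgebra.
Variables (R : realType) (G : riemLieAlgebra R).
Implicit Types (D : {bilinear G -> G -> G}) (s : seq G).

Lemma dotC (u w : G) : ⟨u, w⟩ = ⟨w, u⟩.
Proof. by rewrite hermC expr0 mul1r. Qed.

Lemma dotDl (u v w : G) : ⟨u + v, w⟩ = ⟨u, w⟩ + ⟨v, w⟩.
Proof. exact: linearDl. Qed.
Lemma dotDr (u v w : G) : ⟨w, u + v⟩ = ⟨w, u⟩ + ⟨w, v⟩.
Proof. exact: linearDr. Qed.
Lemma dotZl a (u w : G) : ⟨a *: u, w⟩ = a * ⟨u, w⟩.
Proof. exact: linearZl_LR. Qed.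
Lemma dotZr a (u w : G) : ⟨w, a *: u⟩ = a * ⟨w, u⟩.
Proof. exact: linearZr_LR. Qed.
Lemma dotNl (u w : G) : ⟨- u, w⟩ = - ⟨u, w⟩.
Proof. exact: linearNl. Qed.
Lemma dotNr (u w : G) : ⟨w, - u⟩ = - ⟨w, u⟩.
Proof. exact: linearNr. Qed.
Lemma dot0l (w : G) : ⟨0, w⟩ = 0.
Proof. exact: linear0l. Qed.
Lemma dot0r (w : G) : ⟨w, 0⟩ = 0.
Proof. exact: linear0r. Qed.
Definition dotE :=
  (dotDl, dotDr, dotNl, dotNr, dotZl, dotZr, dot0l, dot0r).

Lemma bilDl D u v w : D (u + v) w = D u w + D v w.
Proof. exact: linearDl. Qed.
Lemma bilDr D u v w : D w (u + v) = D w u + D w v.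
Proof. exact: linearDr. Qed.
Lemma bilZl D a u w : D (a *: u) w = a *: D u w.
Proof. exact: linearZl_LR. Qed.
Lemma bilZr D a u w : D w (a *: u) = a *: D w u.
Proof. exact: linearZr_LR. Qed.
Lemma bilNl D u w : D (- u) w = - D u w.
Proof. exact: linearNl. Qed.
Lemma bilNr D u w : D w (- u) = - D w u.
Proof. exact: linearNr. Qed.
Lemma bil0l D w : D 0 w = 0.
Proof. exact: linear0l. Qed.
Lemma bil0r D w : D w 0 = 0.
Proof. exact: linear0r. Qed.
Definition bilE :=
  (bilDl, bilDr, bilNl, bilNr, bilZl, bilZr, bil0l, bil0r).

Lemma dot_eq0 (u : G) : ⟨u, u⟩ = 0 -> u = 0.
Proof.
by move=> uu; apply/eqP/negPn/negP => /(@neq0_dnorm_gt0 _ _ _ metric); rewrite uu ltxx.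
Qed.

Lemma dot_inj (u w : G) : (forall t, ⟨u, t⟩ = ⟨w, t⟩) -> u = w.
Proof.
move=> uw; apply/subr0_eq/dot_eq0.
by rewrite dotDl dotNl uw subrr.
Qed.

Lemma lieC (u w : G) : ⟦u, w⟧ = - ⟦w, u⟧.
Proof.
apply/eqP; rewrite -addr_eq0; apply/eqP.
by have := lie_alt (u + w); rewrite !bilE !lie_alt add0r addr0.
Qed.

(** The Jacobi identity is used in this form, because every step below lets
some field act on a subalgebra by a derivation. *)
Lemma lie_derivation (u v w : G) : ⟦⟦u, v⟧, w⟧ = ⟦⟦u, w⟧, v⟧ + ⟦u, ⟦v, w⟧⟧.
Proof.
have ->: ⟦⟦u, w⟧, v⟧ = ⟦v, ⟦w, u⟧⟧ by rewrite lieC -bilNr -lieC.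
by rewrite lieC; apply/esym/eqP; rewrite -addr_eq0 [X in X + _]addrC lie_jacobi.
Qed.

(** ** Expansions in orthonormal families *)

Lemma orthonormal_cons x s :
  orthonormal metric (x :: s) ->
  [/\ ⟨x, x⟩ = 1, {in s, forall e, ⟨x, e⟩ = 0} & orthonormal metric s].
Proof.
rewrite /orthonormal /= andbT => /andP[/andP[/eqP xx s1] /andP[xs ss]].
by split; rewrite ?s1 //= => e es; apply/eqP; exact: (allP xs e es).
Qed.

Lemma orthonormal_gram s : orthonormal metric s ->
  forall i j, (i < size s)%N -> (j < size s)%N -> ⟨s`_i, s`_j⟩ = (i == j)%:R.
Proof.
elim: s => [//|x s IH /orthonormal_cons[xx xs os]] [|i] [|j] //= hi hj.
- by rewrite xs ?mem_nth.
- by rewrite dotC xs ?mem_nth.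
- exact: IH.
Qed.

Lemma dot_span0 (u : G) s :
  {in s, forall e, ⟨u, e⟩ = 0} -> {in <<s>>%VS, forall w, ⟨u, w⟩ = 0}.
Proof.
move=> us w; rewrite span_def big_tnth => /memv_sumP[f fs ->].
rewrite linear_sumr big1 //= => i _.
have /vlineP[k ->] := fs i isT.
by rewrite dotZr us ?mulr0 ?mem_tnth.
Qed.

Lemma span_expansion s : orthonormal metric s ->
  {in <<s>>%VS, forall u, u = \sum_(e <- s) ⟨u, e⟩ *: e}.
Proof.
elim: s => [_ u|x s IH /orthonormal_cons[xx xs os] u].
  by rewrite span_nil memv0 big_nil => /eqP.
rewrite span_cons => /memv_addP[_ /vlineP[k ->] [w ws ->]].
rewrite big_cons dotDl dotZl xx mulr1 (dotC w) (dot_span0 xs ws) addr0.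
congr (_ + _); rewrite {1}(IH os w ws) [LHS]big_seq [RHS]big_seq.
by apply: eq_bigr => e es; rewrite dotDl dotZl xs // mulr0 add0r.
Qed.

Lemma dot_expansion s (u : G) : orthonormal metric s ->
  {in s, forall e, ⟨\sum_(f <- s) ⟨u, f⟩ *: f, e⟩ = ⟨u, e⟩}.
Proof.
elim: s => [//|x s IH /orthonormal_cons[xx xs os] e].
have xP : ⟨\sum_(f <- s) ⟨u, f⟩ *: f, x⟩ = 0.
  rewrite linear_sumlz big_seq big1 //= => f fs.
  by rewrite dotZl dotC xs ?mulr0.
rewrite inE big_cons dotDl dotZl => /orP[/eqP ->|es].
  by rewrite xx xP mulr1 addr0.
by rewrite xs // mulr0 add0r IH.
Qed.

Lemma gram3 (x y z : G) : orthonormal metric [:: x; y; z] ->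
  (⟨x, x⟩ = 1) * (⟨y, y⟩ = 1) * (⟨z, z⟩ = 1) *
  (⟨x, y⟩ = 0) * (⟨y, x⟩ = 0) * (⟨x, z⟩ = 0) * (⟨z, x⟩ = 0) *
  (⟨y, z⟩ = 0) * (⟨z, y⟩ = 0).
Proof.
move=> os; have g i j := @orthonormal_gram _ os i j.
do !split; first [exact: (g 0 0)%N | exact: (g 1 1)%N | exact: (g 2 2)%N
  | exact: (g 0 1)%N | exact: (g 1 0)%N | exact: (g 0 2)%N
  | exact: (g 2 0)%N | exact: (g 1 2)%N | exact: (g 2 1)%N ].
Qed.

Lemma expansion3 (x y z u : G) :
  orthonormal metric [:: x; y; z] -> u \in <<[:: x; y; z]>>%VS ->
  u = ⟨u, x⟩ *: x + ⟨u, y⟩ *: y + ⟨u, z⟩ *: z.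
Proof.
move=> os us; rewrite {1}(span_expansion os us).
by rewrite !big_cons big_nil addr0 addrA.
Qed.

(** ** Splitting along the span of an orthonormal family *)

Lemma horizontal_span s (u : G) :
  {in s, forall e, ⟨u, e⟩ = 0} -> u \in horizontal <<s>>%VS.
Proof. by move=> us; apply/mem_orthovP => w /(dot_span0 us). Qed.

Lemma horizontal_dot (V : {vspace G}) u w :
  u \in horizontal V -> w \in V -> ⟨u, w⟩ = 0.
Proof. by move/mem_orthovP => uV /uV. Qed.

Lemma cap_horizontal (V : {vspace G}) : (V :&: horizontal V = 0)%VS.
Proof.
apply/eqP; rewrite -subv0; apply/subvP => u /memv_capP[uV uH].
by rewrite memv0 (dot_eq0 (horizontal_dot uH uV)).
Qed.

(** The orthogonal projection onto the span is explicit, so an orthonormal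
spanning family makes the complement work in any ambient dimension. *)
Lemma add_horizontal s :
  orthonormal metric s -> (<<s>> + horizontal <<s>> = fullv)%VS.
Proof.
move=> os; apply/eqP; rewrite eqEsubv subvf; apply/subvP => u _.
rewrite -[u](subrKC (\sum_(e <- s) ⟨u, e⟩ *: e)) memv_add //.
  by rewrite big_seq memv_suml // => e es; rewrite memvZ ?memv_span.
apply: horizontal_span => e es.
by rewrite dotDl dotNl dot_expansion // subrr.
Qed.

Lemma projV_dot s (u w : G) : orthonormal metric s -> w \in <<s>>%VS ->
  ⟨projV <<s>>%VS u, w⟩ = ⟨u, w⟩.
Proof.
move=> os ws; have uf : u \in (<<s>> + horizontal <<s>>)%VS.
  by rewrite add_horizontal // memvf.
rewrite -[in RHS](daddv_pi_add (cap_horizontal _) uf) dotDl.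
by rewrite (horizontal_dot (memv_pi _ _ _) ws) addr0.
Qed.

Lemma projH_dot s (u w : G) : orthonormal metric s ->
  w \in horizontal <<s>>%VS -> ⟨projH <<s>>%VS u, w⟩ = ⟨u, w⟩.
Proof.
move=> os wH; have uf : u \in (<<s>> + horizontal <<s>>)%VS.
  by rewrite add_horizontal // memvf.
rewrite -[in RHS](daddv_pi_add (cap_horizontal _) uf) dotDl.
by rewrite [X in X + _]dotC (horizontal_dot wH (memv_pi _ _ _)) add0r.
Qed.

(** ** The Levi-Civita connection *)

(** Permuting the three arguments cyclically and adding with alternating signs,
metric compatibility cancels all terms except two equal ones; the derivatives of the
functions <U, W> vanish since all fields are left-invariant. *)
Lemma koszul D : levi_civita D -> forall u w t,
  2 * ⟨D u w, t⟩ = ⟨⟦u, w⟧, t⟩ - ⟨⟦w, t⟧, u⟩ + ⟨⟦t, u⟧, w⟩.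
Proof.
move=> [tors compat] u w t.
have := compat u w t; have := compat t w u; have := compat w t u.
rewrite -!tors !dotE (dotC _ (D u t)) (dotC _ (D t u)) (dotC _ (D w u)) => h1 h2 h3.
lra.
Qed.

(** The Koszul formula is its own existence proof: its right-hand side is
linear in the last argument, hence given by a vector. *)
Lemma levi_civita_exists s : orthonormal metric s ->
  (forall u, u \in <<s>>%VS) -> exists D, levi_civita D.
Proof.
move=> os sf.
pose k (u w t : G) : R := 2^-1 * (⟨⟦u, w⟧, t⟩ - ⟨⟦w, t⟧, u⟩ + ⟨⟦t, u⟧, w⟩).
pose d (u w : G) : G := \sum_(e <- s) k u w e *: e.
have kl a u v w t : k (a *: u + v) w t = a * k u w t + k v w t.
  by rewrite /k !(bilE, dotE); ring.
have kr a u v w t : k w (a *: u + v) t = a * k w u t + k w v t.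
  by rewrite /k !(bilE, dotE); ring.
have kt a u v w t : k w t (a *: u + v) = a * k w t u + k w t v.
  by rewrite /k !(bilE, dotE); ring.
have dbil : bilinear_for *:%R *:%R d.
  split=> w a u v; rewrite /d /= scaler_sumr -big_split /=; apply: eq_bigr => e _.
    by rewrite kl scalerDl scalerA.
  by rewrite kr scalerDl scalerA.
pose D : {bilinear G -> G -> G} :=
  HB.pack d (bilinear_isBilinear.Build R _ _ _ _ _ d dbil).
have dk u w t : ⟨D u w, t⟩ = k u w t.
  have k0 : k u w 0 = 0 by rewrite /k !(bilE, dotE); ring.
  rewrite [t in RHS](span_expansion os (sf t)) /D /= /d linear_sumlz.
  elim/big_rec2: _ => [|e x y _ ->]; first by rewrite k0.
  by rewrite /= kt dotZl (dotC t) mulrC.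
exists D; split=> [u w|t u w].
  apply: dot_inj => t; rewrite !dotE !dk /k (lieC w u) (lieC t u) (lieC t w).
  by rewrite !dotE; field.
rewrite (dotC u) !dk /k (lieC w u) (lieC t w) (lieC t u) !dotE.
by field.
Qed.

(** Symmetrising kills the torsion term of the Koszul formula. What remains
reads the second fundamental forms off the bracket: up to a factor they measure
how far the action of a field normal to the distribution is from being skew. *)
Lemma koszul_sym D : levi_civita D -> forall u w t,
  ⟨D u w + D w u, t⟩ = ⟨⟦t, u⟧, w⟩ + ⟨⟦t, w⟧, u⟩.
Proof.
move=> lc u w t; have := koszul lc u w t; have := koszul lc w u t.
by rewrite dotE (lieC w u) (lieC w t) (lieC u t) !dotE; lra.
Qed.

Lemma BV_dot D s : orthonormal metric s -> levi_civita D ->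
  forall u w t, t \in horizontal <<s>>%VS ->
  2 * ⟨BV D <<s>>%VS u w, t⟩ = ⟨⟦t, u⟧, w⟩ + ⟨⟦t, w⟧, u⟩.
Proof.
move=> os lc u w t tH; rewrite dotZl projH_dot // koszul_sym // mulrA divff ?mul1r //.
by rewrite pnatr_eq0.
Qed.

Lemma BH_dot D s : orthonormal metric s -> levi_civita D ->
  forall u w t, t \in <<s>>%VS ->
  2 * ⟨BH D <<s>>%VS u w, t⟩ = ⟨⟦t, u⟧, w⟩ + ⟨⟦t, w⟧, u⟩.
Proof.
move=> os lc u w t tV; rewrite dotZl projV_dot // koszul_sym // mulrA divff ?mul1r //.
by rewrite pnatr_eq0.
Qed.

(** [BV] takes its values in the complement and [BH] in the distribution, where
the metric is nondegenerate, so vanishing can be tested on the pairings. *)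
Lemma BV_eq0P D s u w : orthonormal metric s -> levi_civita D ->
  BV D <<s>>%VS u w = 0 <->
  {in horizontal <<s>>%VS, forall t, ⟨⟦t, u⟧, w⟩ + ⟨⟦t, w⟧, u⟩ = 0}.
Proof.
move=> os lc; split=> [b0 t tH|h].
  by rewrite -(BV_dot os lc) // b0 dot0l mulr0.
apply: dot_eq0; set b := BV _ _ _ _.
have bH : b \in horizontal <<s>>%VS by rewrite memvZ ?memv_pi.
by have := BV_dot os lc u w bH; rewrite h // -/b; lra.
Qed.

Lemma BH_eq0P D s u w : orthonormal metric s -> levi_civita D ->
  BH D <<s>>%VS u w = 0 <->
  {in <<s>>%VS, forall t, ⟨⟦t, u⟧, w⟩ + ⟨⟦t, w⟧, u⟩ = 0}.
Proof.
move=> os lc; split=> [b0 t tH|h].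
  by rewrite -(BH_dot os lc) // b0 dot0l mulr0.
apply: dot_eq0; set b := BH _ _ _ _.
have bV : b \in <<s>>%VS by rewrite memvZ ?memv_pi.
by have := BH_dot os lc u w bV; rewrite h // -/b; lra.
Qed.

End MetricLieAlgebra.

(** * Three-dimensional Berger spheres *)

Section BergerSphere.
Variables (R : realType) (G : riemLieAlgebra R) (lambda : R) (x y z : G).
Hypothesis lambda_gt0 : 0 < lambda.
Hypothesis os : orthonormal metric [:: x; y; z].
Hypothesis span_xyz : forall u, u \in <<[:: x; y; z]>>%VS.
Hypothesis su2 : su2_relations lambda x y z.

Let gram := gram3 os.

Lemma berger_expansion (u : G) : u = ⟨u, x⟩ *: x + ⟨u, y⟩ *: y + ⟨u, z⟩ *: z.
Proof. exact: expansion3 os (span_xyz u). Qed.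

Lemma berger_dot (u w : G) :
  ⟨u, w⟩ = ⟨u, x⟩ * ⟨w, x⟩ + ⟨u, y⟩ * ⟨w, y⟩ + ⟨u, z⟩ * ⟨w, z⟩.
Proof. by rewrite {1}(berger_expansion u) !dotE !(dotC _ w). Qed.

Lemma berger_lie (a b c a' b' c' : R) :
  ⟦a *: x + b *: y + c *: z, a' *: x + b' *: y + c' *: z⟧ =
    (2 / lambda * (b * c' - c * b')) *: x +
    (2 * lambda * (c * a' - a * c')) *: y +
    (2 * lambda * (a * b' - b * a')) *: z.
Proof.
case: su2 => xy zx yz; apply: dot_inj => t.
rewrite !bilE !lie_alt (lieC y x) (lieC x z) (lieC z y) xy zx yz !dotE.
by ring.
Qed.

Section Connection.
Variables (D : {bilinear G -> G -> G}) (lcD : levi_civita D).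

(** Milnor's formulas for a unimodular three-dimensional group: with structure
constants [c1 = 2 / lambda] and [c2 = c3 = 2 * lambda], the coefficients are
[mu_i = (c1 + c2 + c3) / 2 - c_i], that is [mu1 = 2 * lambda - lambda^-1] and
[mu2 = mu3 = lambda^-1]. *)
Lemma berger_connection (u w : G) : D u w =
  (lambda^-1 * (⟨u, y⟩ * ⟨w, z⟩ - ⟨u, z⟩ * ⟨w, y⟩)) *: x +
  (lambda^-1 * ⟨u, z⟩ * ⟨w, x⟩
   - (2 * lambda - lambda^-1) * ⟨u, x⟩ * ⟨w, z⟩) *: y +
  ((2 * lambda - lambda^-1) * ⟨u, x⟩ * ⟨w, y⟩
   - lambda^-1 * ⟨u, y⟩ * ⟨w, x⟩) *: z.
Proof.
have l0 : lambda != 0 by rewrite gt_eqF.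
apply: dot_inj => t; apply: (mulfI (_ : 2 != 0 :> R)); first by rewrite pnatr_eq0.
rewrite (koszul lcD) (berger_expansion u) (berger_expansion w) (berger_expansion t).
move: ⟨u, x⟩ ⟨u, y⟩ ⟨u, z⟩ ⟨w, x⟩ ⟨w, y⟩ ⟨w, z⟩ ⟨t, x⟩ ⟨t, y⟩ ⟨t, z⟩.
move=> u1 u2 u3 w1 w2 w3 t1 t2 t3; rewrite !berger_lie !dotE !gram.
by field.
Qed.


Let connectionE (u w : G) :
  (⟨D u w, x⟩ = lambda^-1 * (⟨u, y⟩ * ⟨w, z⟩ - ⟨u, z⟩ * ⟨w, y⟩)) *
  (⟨D u w, y⟩ = lambda^-1 * ⟨u, z⟩ * ⟨w, x⟩
                - (2 * lambda - lambda^-1) * ⟨u, x⟩ * ⟨w, z⟩) *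
  (⟨D u w, z⟩ = (2 * lambda - lambda^-1) * ⟨u, x⟩ * ⟨w, y⟩
                - lambda^-1 * ⟨u, y⟩ * ⟨w, x⟩).
Proof. by rewrite berger_connection !dotE !gram; do !split; ring. Qed.

Let lie_coordE (u w : G) :
  (⟨⟦u, w⟧, x⟩ = 2 / lambda * (⟨u, y⟩ * ⟨w, z⟩ - ⟨u, z⟩ * ⟨w, y⟩)) *
  (⟨⟦u, w⟧, y⟩ = 2 * lambda * (⟨u, z⟩ * ⟨w, x⟩ - ⟨u, x⟩ * ⟨w, z⟩)) *
  (⟨⟦u, w⟧, z⟩ = 2 * lambda * (⟨u, x⟩ * ⟨w, y⟩ - ⟨u, y⟩ * ⟨w, x⟩)).
Proof.
rewrite [in ⟦u, w⟧](berger_expansion u) [in ⟦_, w⟧](berger_expansion w).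
by rewrite berger_lie !dotE !gram; do !split; ring.
Qed.

Lemma berger_sectional_xy : ⟨curvature D x y y, x⟩ = lambda ^- 2.
Proof.
have l0 : lambda != 0 by rewrite gt_eqF.
rewrite /curvature !dotE !connectionE !lie_coordE !gram.
by field.
Qed.

Lemma berger_sectional_yz : ⟨curvature D y z z, y⟩ = 4 - 3 * lambda ^- 2.
Proof.
have l0 : lambda != 0 by rewrite gt_eqF.
rewrite /curvature !dotE !connectionE !lie_coordE !gram.
by field.
Qed.

(** For [lambda = 1] the metric is bi-invariant, so that the connection is half
of the bracket, the left-hand side is a quarter of the squared length of
[⟦u, w⟧], and the bracket is twice a vector product; this is Lagrange's
identity. *)
Lemma round_sectional (u w : G) : lambda = 1 ->
  ⟨curvature D u w w, u⟩ = ⟨u, u⟩ * ⟨w, w⟩ - ⟨u, w⟩ ^+ 2.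
Proof.
move=> l1; rewrite (berger_dot _ u) (berger_dot u u) (berger_dot w w) (berger_dot u w) /curvature !dotE !connectionE !lie_coordE l1 invr1.
by ring.
Qed.

End Connection.

(** The planes [x, y] and [y, z] have curvatures [lambda ^- 2] and
[4 - 3 * lambda ^- 2]; these agree only if [lambda ^+ 2 = 1]. *)
Lemma berger_round :
  (exists2 kappa : R, 0 < kappa & constant_sectional_curvature G kappa)
  <-> lambda = 1.
Proof.
have l0 : lambda != 0 by rewrite gt_eqF.
split=> [[kappa _ [D lcD K]]|l1].
  have := K y z; have := K x y.
  rewrite berger_sectional_xy // berger_sectional_yz // !gram => <- e.
  have /eqP : lambda ^+ 2 = 1.
    have -> : lambda ^+ 2 = 1 + lambda ^+ 2 / 4 *
      ((4 - 3 * lambda ^- 2) - lambda ^- 2) by field.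
    by rewrite e subrr mulr0 addr0.
  by rewrite sqrf_eq1 => /orP[/eqP //|/eqP l1]; move: lambda_gt0; rewrite l1; lra.
exists 1; first exact: ltr01.
have [D lcD] := levi_civita_exists os span_xyz.
by exists D => // u w; rewrite mul1r round_sectional.
Qed.

End BergerSphere.

(** * Distributions generated by su(2) *)

(** ** Leaves *)

Section LeafFrame.
Variables (R : realType) (G : riemLieAlgebra R) (X Y Z : G).
Let V : {vspace G} := <<[:: X; Y; Z]>>%VS.
Hypotheses (intV : integrable V) (os : orthonormal metric [:: X; Y; Z]).

Let XV : X \in V. Proof. by rewrite memv_span ?inE ?eqxx. Qed.
Let YV : Y \in V. Proof. by rewrite memv_span ?inE ?eqxx ?orbT. Qed.
Let ZV : Z \in V. Proof. by rewrite memv_span ?inE ?eqxx ?orbT. Qed.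

Let x : leaf intV := vsproj V X.
Let y : leaf intV := vsproj V Y.
Let z : leaf intV := vsproj V Z.

Lemma leaf_orthonormal : orthonormal metric [:: x; y; z].
Proof.
move: os; rewrite /orthonormal /= /metric /= /leaf_metric.
by rewrite !vsprojK.
Qed.

Lemma leaf_span (u : leaf intV) : u \in <<[:: x; y; z]>>%VS.
Proof.
rewrite -[u](vsvalK) (span_expansion os (subvsP u)) !big_cons big_nil addr0.
by rewrite !linearD !linearZ /= !memvD // memvZ ?memv_span // !inE eqxx ?orbT.
Qed.

Lemma leaf_su2 lambda : su2_relations lambda X Y Z -> su2_relations lambda x y z.
Proof.
case=> xy zx yz; split; rewrite /= /leaf_lie !vsprojK // ?xy ?zx ?yz linearZ //.
Qed.

Lemma round_leaf lambda : 0 < lambda -> su2_relations lambda X Y Z ->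
  (exists2 kappa : R, 0 < kappa &
    constant_sectional_curvature (leaf intV) kappa) <-> lambda = 1.
Proof.
move=> l0 /leaf_su2 su2.
exact: berger_round l0 leaf_orthonormal leaf_span su2.
Qed.

End LeafFrame.

(** ** Derivations *)

Section Derivations.
Variables (R : realType) (G : riemLieAlgebra R) (lambda : R) (X Y Z : G).
Hypotheses (lambda_gt0 : 0 < lambda) (os : orthonormal metric [:: X; Y; Z]).
Hypothesis su2 : su2_relations lambda X Y Z.
Let V : {vspace G} := <<[:: X; Y; Z]>>%VS.

(** Every derivation of su(2) is inner, hence skew for the Killing form. With
these brackets the Killing form is a multiple of the one for which X, Y, Z are
orthogonal with squared lengths [lambda ^+ 2], 1, 1: this is the origin of the
factor [lambda ^+ 2] in the image of X. *)
Lemma su2_derivation (E : G) :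
  ⟦X, E⟧ \in V -> ⟦Y, E⟧ \in V -> ⟦Z, E⟧ \in V ->
  exists a b c : R,
    [/\ ⟦X, E⟧ = - (lambda ^+ 2 * a) *: Y - (lambda ^+ 2 * b) *: Z,
        ⟦Y, E⟧ = a *: X + c *: Z & ⟦Z, E⟧ = b *: X - c *: Y].
Proof.
have [xy zx yz] := su2; have gram := gram3 os.
have l0 : lambda != 0 by rewrite gt_eqF.
pose coords (u : G) := (⟨u, X⟩, ⟨u, Y⟩, ⟨u, Z⟩).
have span u : u \in V -> exists a b c, u = a *: X + b *: Y + c *: Z.
  by move/(expansion3 os); do 3!eexists; eassumption.
move=> /span[x1 [x2 [x3 hX]]] /span[y1 [y2 [y3 hY]]] /span[z1 [z2 [z3 hZ]]].
have lieE := (lie_alt, xy, zx, yz, lieC Y X, lieC X Z, lieC Z Y).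
have := congr1 coords (lie_derivation X Y E).
have := congr1 coords (lie_derivation Z X E).
have := congr1 coords (lie_derivation Y Z E).
rewrite /coords !lieE !bilE hX hY hZ !bilE !lieE !dotE !gram.
move=> [e1 e2 e3] [f1 f2 f3] [g1 g2 g3].
have k0 : 2 * lambda != 0 by rewrite mulf_neq0 ?pnatr_eq0.
have k1 : 2 / lambda != 0 by rewrite mulf_neq0 ?invr_neq0 ?pnatr_eq0.
(* The diagonal entries satisfy the three equations a = b + c up to cyclic
   permutation, and therefore vanish. *)
have e1' : x1 = y2 + z3 by apply: (mulfI k1); lra.
have f2' : y2 = z3 + x1 by apply: (mulfI k0); lra.
have g3' : z3 = x1 + y2 by apply: (mulfI k0); lra.
have -> : x1 = 0 by lra.
have -> : y2 = 0 by lra.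
have -> : z3 = 0 by lra.
have square c : 2 / lambda * - (lambda ^+ 2 * c) = - (2 * lambda * c) by field.
have -> : x2 = - (lambda ^+ 2 * y1) by apply: (mulfI k1); rewrite square; lra.
have -> : x3 = - (lambda ^+ 2 * z1) by apply: (mulfI k1); rewrite square; lra.
have -> : z2 = - y3 by apply: (mulfI k0); lra.
exists y1, z1, y3.
by rewrite !scale0r !scaleNr add0r !addr0.
Qed.
End Derivations.

(** ** Conformal distributions generated by su(2) *)

Section Adapted.
Variables (R : realType) (G : riemLieAlgebra R) (lambda : R).
Variables (D : {bilinear G -> G -> G}) (X Y Z A B : G).
Hypotheses (lambda_gt0 : 0 < lambda) (frame : adapted_basis D X Y Z A B).
Hypothesis su2 : su2_relations lambda X Y Z.
Let V : {vspace G} := <<[:: X; Y; Z]>>%VS.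
Let H : {vspace G} := horizontal V.

Let gram : (⟨X, X⟩ = 1) * (⟨Y, Y⟩ = 1) * (⟨Z, Z⟩ = 1) *
  (⟨X, Y⟩ = 0) * (⟨Y, X⟩ = 0) * (⟨X, Z⟩ = 0) * (⟨Z, X⟩ = 0) *
  (⟨Y, Z⟩ = 0) * (⟨Z, Y⟩ = 0) *
  (⟨A, A⟩ = 1) * (⟨B, B⟩ = 1) * (⟨A, B⟩ = 0) * (⟨B, A⟩ = 0) *
  (⟨X, A⟩ = 0) * (⟨A, X⟩ = 0) * (⟨Y, A⟩ = 0) * (⟨A, Y⟩ = 0) *
  (⟨Z, A⟩ = 0) * (⟨A, Z⟩ = 0) * (⟨X, B⟩ = 0) * (⟨B, X⟩ = 0) *
  (⟨Y, B⟩ = 0) * (⟨B, Y⟩ = 0) * (⟨Z, B⟩ = 0) * (⟨B, Z⟩ = 0).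
Proof.
have g i j := orthonormal_gram (adapted_orthonormal frame) (i := i) (j := j).
do !split; first [exact: (g 0 0)%N | exact: (g 1 1)%N | exact: (g 2 2)%N
  | exact: (g 0 1)%N | exact: (g 1 0)%N | exact: (g 0 2)%N
  | exact: (g 2 0)%N | exact: (g 1 2)%N | exact: (g 2 1)%N
  | exact: (g 3 3)%N | exact: (g 4 4)%N | exact: (g 3 4)%N | exact: (g 4 3)%N
  | exact: (g 0 3)%N | exact: (g 3 0)%N | exact: (g 1 3)%N | exact: (g 3 1)%N
  | exact: (g 2 3)%N | exact: (g 3 2)%N | exact: (g 0 4)%N | exact: (g 4 0)%N
  | exact: (g 1 4)%N | exact: (g 4 1)%N | exact: (g 2 4)%N | exact: (g 4 2)%N].
Qed.

Let os : orthonormal metric [:: X; Y; Z].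
Proof. by rewrite /orthonormal /= !gram !eqxx. Qed.

Let lc : levi_civita D := adapted_levi_civita frame.

Let XV : X \in V. Proof. by rewrite memv_span ?inE ?eqxx. Qed.
Let YV : Y \in V. Proof. by rewrite memv_span ?inE ?eqxx ?orbT. Qed.
Let ZV : Z \in V. Proof. by rewrite memv_span ?inE ?eqxx ?orbT. Qed.

Let dot_horizontal e : ⟨e, X⟩ = 0 -> ⟨e, Y⟩ = 0 -> ⟨e, Z⟩ = 0 -> e \in H.
Proof.
move=> eX eY eZ; apply: horizontal_span => w.
by rewrite !inE => /or3P[] /eqP ->.
Qed.

Let memA : A \in H. Proof. by apply: dot_horizontal; rewrite gram. Qed.
Let memB : B \in H. Proof. by apply: dot_horizontal; rewrite gram. Qed.

Let expansion5 u : u =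
  ⟨u, X⟩ *: X + ⟨u, Y⟩ *: Y + ⟨u, Z⟩ *: Z + (⟨u, A⟩ *: A + ⟨u, B⟩ *: B).
Proof.
have uV : u \in <<[:: X; Y; Z; A; B]>>%VS.
  by have /andP[/eqP -> _] := adapted_basis_of frame; rewrite memvf.
rewrite {1}(span_expansion (adapted_orthonormal frame) uV).
by rewrite !big_cons big_nil addr0 !addrA.
Qed.

Let memV u : ⟨u, A⟩ = 0 -> ⟨u, B⟩ = 0 -> u \in V.
Proof.
move=> uA uB; rewrite [u]expansion5 uA uB !scale0r !addr0.
by rewrite !memvD ?memvZ.
Qed.

Let expansionV u : u \in V -> u = ⟨u, X⟩ *: X + ⟨u, Y⟩ *: Y + ⟨u, Z⟩ *: Z.
Proof. exact: expansion3. Qed.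

Let expansionH e : e \in H -> e = ⟨e, A⟩ *: A + ⟨e, B⟩ *: B.
Proof.
move=> eH; rewrite {1}[e]expansion5 (horizontal_dot eH XV) (horizontal_dot eH YV)
  (horizontal_dot eH ZV).
by rewrite !scale0r !add0r.
Qed.

Let lieV u w : u \in V -> w \in V -> ⟦u, w⟧ \in V.
Proof. exact: adapted_integrable frame u w. Qed.

Let dotVH u e : u \in V -> e \in H -> ⟨u, e⟩ = 0.
Proof. by move=> uV eH; rewrite dotC (horizontal_dot eH). Qed.

(** [V] is a subalgebra, so it acts on [G / V]: modulo [V], only the horizontal
part of [u] matters. *)
Let action_mod t u e : t \in V -> e \in H ->
  ⟨⟦t, u⟧, e⟩ = ⟨u, A⟩ * ⟨⟦t, A⟧, e⟩ + ⟨u, B⟩ * ⟨⟦t, B⟧, e⟩.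
Proof.
move=> tV eH; rewrite [in LHS](expansion5 u) bilDr dotDl dotVH ?lieV //.
  by rewrite !bilE !dotE add0r.
by rewrite !memvD ?memvZ.
Qed.

(** In the basis A, B every element of [V] acts on [G / V] as a similarity
matrix, a multiple of the identity plus a skew matrix. *)
Lemma conformal_action : exists n : G -> R, {in V, forall t,
  [/\ ⟨⟦t, A⟧, A⟩ = n t, ⟨⟦t, B⟧, B⟩ = n t & ⟨⟦t, B⟧, A⟩ = - ⟨⟦t, A⟧, B⟩]}.
Proof.
have [N NV bhN] := adapted_conformal frame; exists (fun t => ⟨N, t⟩) => t tV.
have conf e f : e \in H -> f \in H ->
    ⟨⟦t, e⟧, f⟩ + ⟨⟦t, f⟧, e⟩ = 2 * (⟨e, f⟩ * ⟨N, t⟩).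
  by move=> eH fH; rewrite -(BH_dot os lc) // bhN // dotZl.
have := conf A A memA memA; have := conf B B memB memB; have := conf A B memA memB.
by rewrite !gram => *; split; lra.
Qed.

(** In dimension two the similarity matrices commute, and commutators in [V]
act on [G / V] by commutators of such matrices. *)
Lemma commutator_action_trivial t u e f : t \in V -> u \in V -> e \in H -> f \in H ->
  ⟨⟦⟦t, u⟧, e⟧, f⟩ = 0.
Proof.
move=> tV uV eH fH; rewrite lie_derivation (lieC _ u) dotDl dotNl.
rewrite (action_mod ⟦u, e⟧ tV fH) (action_mod ⟦t, e⟧ uV fH).
rewrite (expansionH eH) (expansionH fH) !bilE !dotE.
have [n conf] := conformal_action.
have [-> -> ->] := conf t tV; have [-> -> ->] := conf u uV.
by ring.
Qed.

(** su(2) is perfect: each of X, Y, Z is a multiple of a bracket of the other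
two. *)
Lemma action_trivial t e f : t \in V -> e \in H -> f \in H ->
  ⟨⟦t, e⟧, f⟩ = 0.
Proof.
move=> tV eH fH; have [xy zx yz] := su2.
have l0 : lambda != 0 by rewrite gt_eqF.
have k0 : 2 * lambda != 0 by rewrite mulf_neq0 ?pnatr_eq0.
have k1 : 2 / lambda != 0 by rewrite mulf_neq0 ?invr_neq0 ?pnatr_eq0.
have scaled k u : k != 0 -> ⟨⟦k *: u, e⟧, f⟩ = 0 -> ⟨⟦u, e⟧, f⟩ = 0.
  by move=> kN0 /eqP; rewrite !bilE !dotE mulf_eq0 (negPf kN0) => /eqP.
have Xe : ⟨⟦X, e⟧, f⟩ = 0.
  by apply: scaled k1 _; rewrite -yz commutator_action_trivial.
have Ye : ⟨⟦Y, e⟧, f⟩ = 0.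
  by apply: scaled k0 _; rewrite -zx commutator_action_trivial.
have Ze : ⟨⟦Z, e⟧, f⟩ = 0.
  by apply: scaled k0 _; rewrite -xy commutator_action_trivial.
by rewrite (expansionV tV) !bilE !dotE Xe Ye Ze !mulr0 !addr0.
Qed.

Lemma su2_riemannian : riemannian D V.
Proof.
move=> e f eH fH; rewrite scaler0; apply/(BH_eq0P _ _ os lc) => t tV.
by rewrite !action_trivial // addr0.
Qed.

Lemma lie_vertical t e : t \in V -> e \in H -> ⟦t, e⟧ \in V.
Proof. by move=> tV eH; apply: memV; rewrite action_trivial. Qed.

Lemma su2_brackets : exists r x3 x4 x5 x6 z3 z4 theta1 theta2 theta3 : R,
  [/\ su2_relations lambda X Y Z,
      ⟦X, A⟧ = - (lambda ^+ 2 * x3) *: Y - (lambda ^+ 2 * x5) *: Z /\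
      ⟦X, B⟧ = - (lambda ^+ 2 * x4) *: Y - (lambda ^+ 2 * x6) *: Z,
      ⟦Y, A⟧ = x3 *: X + z3 *: Z /\ ⟦Y, B⟧ = x4 *: X + z4 *: Z,
      ⟦Z, A⟧ = x5 *: X - z3 *: Y /\ ⟦Z, B⟧ = x6 *: X - z4 *: Y &
      ⟦A, B⟧ = r *: A + theta1 *: X + theta2 *: Y + theta3 *: Z].
Proof.
have [r [t1 [t2 [t3 AB]]]] := adapted_lieAB frame.
have dA := su2_derivation lambda_gt0 os su2
  (lie_vertical XV memA) (lie_vertical YV memA) (lie_vertical ZV memA).
have dB := su2_derivation lambda_gt0 os su2
  (lie_vertical XV memB) (lie_vertical YV memB) (lie_vertical ZV memB).
have [x3 [x5 [z3 [XA YA ZA]]]] := dA; have [x4 [x6 [z4 [XB YB ZB]]]] := dB.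
by exists r, x3, x4, x5, x6, z3, z4, t1, t2, t3.
Qed.

Lemma totally_geodesic_dot : totally_geodesic D V <->
  forall u w e, u \in V -> w \in V -> e \in H -> ⟨⟦e, u⟧, w⟩ + ⟨⟦e, w⟧, u⟩ = 0.
Proof.
split=> [tg u w e uV wV eH|h u w uV wV].
  by move/(BV_eq0P _ _ os lc): (tg u w uV wV) => /(_ e eH).
by apply/(BV_eq0P _ _ os lc) => e eH; apply: h.
Qed.

Section Relations.
Variables r x3 x4 x5 x6 z3 z4 theta1 theta2 theta3 : R.
Hypotheses (XA : ⟦X, A⟧ = - (lambda ^+ 2 * x3) *: Y - (lambda ^+ 2 * x5) *: Z)
  (XB : ⟦X, B⟧ = - (lambda ^+ 2 * x4) *: Y - (lambda ^+ 2 * x6) *: Z)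
  (YA : ⟦Y, A⟧ = x3 *: X + z3 *: Z) (YB : ⟦Y, B⟧ = x4 *: X + z4 *: Z)
  (ZA : ⟦Z, A⟧ = x5 *: X - z3 *: Y) (ZB : ⟦Z, B⟧ = x6 *: X - z4 *: Y)
  (AB : ⟦A, B⟧ = r *: A + theta1 *: X + theta2 *: Y + theta3 *: Z).

(** su(2) has trivial centre. If [a] and [b] in [V] induce the same derivations
of [V] as A and B, then [A - a] and [B - b] centralise [V], and so does their
bracket; this forces the vertical part of [⟦A, B⟧] to be [⟦a, b⟧ - r *: a].
The Jacobi identity for X, A, B gives its Y and Z components, the one for
Y, A, B the X component. *)
Lemma theta_jacobi :
  [/\ theta1 = 2^-1 * (r * z3 / lambda + lambda * (x3 * x6 - x4 * x5)),
      theta2 = 2^-1 * (lambda * (r * x5 - x3 * z4 + x4 * z3)) &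
      theta3 = 2^-1 * - (lambda * (r * x3 + z4 * x5 - z3 * x6))].
Proof.
have [xy zx yz] := su2; have l0 : lambda != 0 by rewrite gt_eqF.
have lieE := (lie_alt, xy, zx, yz, lieC Y X, lieC X Z, lieC Z Y).
have jX := lie_derivation X A B; have jY := lie_derivation Y A B.
rewrite XA XB AB !bilE YA YB ZA ZB XA !lieE in jX.
rewrite YA YB AB !bilE XA XB ZA ZB YA !lieE in jY.
have := congr1 (fun u => ⟨u, Y⟩) jX; have := congr1 (fun u => ⟨u, Z⟩) jX.
have := congr1 (fun u => ⟨u, Z⟩) jY.
rewrite !dotE !gram => e1 e2 e3.
have k0 : 2 * lambda != 0 by rewrite mulf_neq0 ?pnatr_eq0.
split; apply: (mulfI k0).
- have -> : 2 * lambda * (2^-1 * (r * z3 / lambda + lambda * (x3 * x6 - x4 * x5)))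
    = r * z3 + lambda ^+ 2 * (x3 * x6 - x4 * x5) by field.
  by lra.
- by lra.
- by lra.
Qed.

(** Total geodesy asks that the derivations induced by A and B be skew for the
metric, whereas they are skew for the Killing form. These forms are
proportional if [lambda = 1]; otherwise the rotations moving X are excluded,
and only the rotations of the plane Y, Z (the coefficients [z3] and [z4])
remain. *)
Lemma totally_geodesic_cases :
  totally_geodesic D V <-> lambda = 1 \/ [/\ x3 = 0, x4 = 0, x5 = 0 & x6 = 0].
Proof.
rewrite totally_geodesic_dot; split=> [h|cases u w e uV wV eH]; last first.
  rewrite (expansionV uV) (expansionV wV) (expansionH eH).
  rewrite !bilE !(lieC A) !(lieC B) XA XB YA YB ZA ZB !dotE !gram.
  (* Every term carries a factor (lambda ^+ 2 - 1) * x_i. *)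
  by case: cases => [->|[-> -> -> ->]]; ring.
have [l1|l1] := eqVneq lambda 1; first by left.
have l2 : lambda ^+ 2 - 1 != 0.
  rewrite subr_eq0 sqrf_eq1 negb_or l1 /=.
  by apply/eqP => l1'; move: lambda_gt0; rewrite l1'; lra.
have := h X Y A XV YV memA; have := h X Y B XV YV memB.
have := h X Z A XV ZV memA; have := h X Z B XV ZV memB.
rewrite !(lieC A) !(lieC B) XA XB YA YB ZA ZB !dotE !gram => e6 e5 e4 e3.
by right; split; apply: (mulfI l2); lra.
Qed.

End Relations.

Lemma su2_round_leaves : round_leaves V <-> lambda = 1.
Proof.
split=> [[intV]|l1]; first by move/(round_leaf intV os lambda_gt0 su2).
exists (adapted_integrable frame).
exact/(round_leaf (adapted_integrable frame) os lambda_gt0 su2).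
Qed.

End Adapted.

(** * A family that is totally geodesic only for lambda = 1 *)

Section Example.
Variables (R : realType) (lambda : R).
Hypothesis lambda_neq0 : lambda != 0.

Let T := 'rV[R]_5.
Let coord (u : T) k := u 0 (inord k).

(** Coordinates are taken with respect to X, Y, Z, A, B. This is the product of
a line spanned by B with the extension of su(2) by a line spanned by A, which
acts by the derivation X |-> - lambda ^+ 2 Y, Y |-> X, Z |-> 0: the member of
the family with [x3 = 1] and all other parameters 0. The A and B components of a
bracket are the default value 0 of the sequence. *)
Definition twisted_lie (u w : T) : T := \row_i [::
  2 / lambda * (coord u 1 * coord w 2 - coord u 2 * coord w 1)
    + (coord u 1 * coord w 3 - coord u 3 * coord w 1);
  2 * lambda * (coord u 2 * coord w 0 - coord u 0 * coord w 2)
    - lambda ^+ 2 * (coord u 0 * coord w 3 - coord u 3 * coord w 0);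
  2 * lambda * (coord u 0 * coord w 1 - coord u 1 * coord w 0)]`_i.

Definition twisted_dot (u w : T) : R := \sum_i u 0 i * w 0 i.

Lemma twisted_lie_bilinear : bilinear_for *:%R *:%R twisted_lie.
Proof.
by split=> w a u v; apply/rowP => -[[|[|[|i]]] hi];
  rewrite !mxE /= ?nth_nil /coord ?mxE; ring.
Qed.
HB.instance Definition _ :=
  bilinear_isBilinear.Build R _ _ _ _ _ twisted_lie twisted_lie_bilinear.

Lemma twisted_dot_bilinear : bilinear_for *%R (idfun \; *%R) twisted_dot.
Proof.
by split=> w a u v; rewrite /twisted_dot /= big_distrr -big_split /=;
  apply: eq_bigr => i _; rewrite !mxE; ring.
Qed.
HB.instance Definition _ :=
  bilinear_isBilinear.Build R _ _ _ _ _ twisted_dot twisted_dot_bilinear.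

Lemma twisted_dot_sym u w : twisted_dot u w = (-1) ^+ false * idfun (twisted_dot w u).
Proof. by rewrite expr0 mul1r; apply: eq_bigr => i _; rewrite mulrC. Qed.
HB.instance Definition _ :=
  isHermitianSesquilinear.Build R _ false idfun twisted_dot twisted_dot_sym.

Lemma twisted_dot_gt0 u : u != 0 -> 0 < twisted_dot u u.
Proof.
move=> u0; rewrite lt0r sumr_ge0 ?andbT => [|i _]; last by rewrite -expr2 sqr_ge0.
apply: contra u0 => /eqP /psumr_eq0P uu; apply/eqP/rowP => i.
apply/eqP; rewrite mxE -[_ == 0]orbb -mulf_eq0; apply/eqP/uu => // j _.
by rewrite -expr2 sqr_ge0.
Qed.
HB.instance Definition _ :=
  isDotProduct.Build R _ twisted_dot twisted_dot_gt0.

Lemma twisted_lie_alt u : twisted_lie u u = 0.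
Proof.
by apply/rowP => -[[|[|[|i]]] hi]; rewrite !mxE /= ?nth_nil; ring.
Qed.

Lemma twisted_lie_jacobi x y z :
  twisted_lie x (twisted_lie y z) + twisted_lie y (twisted_lie z x)
  + twisted_lie z (twisted_lie x y) = 0.
Proof.
apply/rowP => -[[|[|[|i]]] hi]; rewrite !mxE /= ?nth_nil ?addr0 //;
  rewrite /coord !mxE !inordK //= -!/(coord _ _).
all: by field.
Qed.

Definition twisted_su2 : riemLieAlgebra R :=
  @RiemLieAlgebra R T twisted_lie twisted_dot twisted_lie_alt twisted_lie_jacobi.

Let e k : twisted_su2 := delta_mx 0 (inord k) : T.

Lemma twisted_dot_delta (u : twisted_su2) k : ⟨u, e k⟩ = coord u k.
Proof.
rewrite /metric /= /twisted_dot (bigD1 (inord k)) //= big1 ?addr0 => [|i ik].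
  by rewrite mxE !eqxx mulr1.
by rewrite mxE eqxx (negPf ik) mulr0.
Qed.

Lemma coord_delta k l : (k < 5)%N -> (l < 5)%N -> coord (e k) l = (k == l)%:R.
Proof.
by move=> hk hl; rewrite /coord mxE eqxx -val_eqE /= !inordK // eq_sym.
Qed.

Let X := e 0. Let Y := e 1. Let Z := e 2. Let A := e 3. Let B := e 4.
Let V : {vspace twisted_su2} := <<[:: X; Y; Z]>>%VS.

Lemma delta_basis_of : basis_of fullv [:: X; Y; Z; A; B].
Proof.
rewrite basisEdim dimvf /= dim_matrix andbT; apply/subvP => u _.
rewrite [u]row_sum_delta memv_suml // => -[k hk] _; rewrite memvZ ?memv_span //.
have -> : delta_mx 0 (Ordinal hk) = e k.
  by rewrite /e; congr delta_mx; apply: val_inj; rewrite /= inordK.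
by move: k hk => [|[|[|[|[|//]]]]] _; rewrite !inE eqxx ?orbT.
Qed.

Lemma delta_orthonormal : orthonormal metric [:: X; Y; Z; A; B].
Proof. by rewrite /orthonormal /= !twisted_dot_delta !coord_delta //= !eqxx. Qed.

Let os : orthonormal metric [:: X; Y; Z].
Proof. by rewrite /orthonormal /= !twisted_dot_delta !coord_delta //= !eqxx. Qed.

Let twisted_lie_vertical (u w : twisted_su2) : ⟦u, w⟧ \in V.
Proof.
have -> : ⟦u, w⟧ = coord ⟦u, w⟧ 0 *: X + coord ⟦u, w⟧ 1 *: Y + coord ⟦u, w⟧ 2 *: Z.
  by apply/rowP => -[[|[|[|[|[|//]]]]] hi];
    rewrite !mxE /coord !mxE -!val_eqE /= !inordK //= /coord; ring.
by rewrite !memvD // memvZ // memv_span // !inE eqxx ?orbT.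
Qed.

Lemma twisted_su2_relations : su2_relations lambda X Y Z.
Proof.
by split; apply/rowP => -[[|[|[|[|[|//]]]]] hi];
  rewrite !mxE /= ?coord_delta // -?val_eqE /= ?inordK //=; ring.
Qed.

(** All brackets are vertical, so the leaves are Riemannian; the derivation by A
has zero diagonal, so X, Y, Z contribute nothing to the trace of [BV]. *)
Lemma twisted_adapted_basis D : levi_civita D -> adapted_basis D X Y Z A B.
Proof.
move=> lc; have bh0 : BH_metric_tensor D V 0.
  move=> u w uH wH; rewrite scaler0; apply/(BH_eq0P _ _ os lc) => t _.
  by rewrite ![⟨⟦_, _⟧, _⟩]dotC !(horizontal_dot _ (twisted_lie_vertical _ _)) // addr0.
have dimV : size [:: X; Y; Z] == \dim V.
  have := basis_free delta_basis_of; rewrite -[[:: X; Y; Z; A; B]]/([:: X; Y; Z] ++ [:: A; B]).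
  by move/catl_free => /eqP ->.
split=> //.
- by rewrite dimvf /= dim_matrix.
- exact: delta_basis_of.
- exact: delta_orthonormal.
- by exists 0; rewrite ?mem0v.
- exists (Tuple dimV).
    rewrite os basisEdim subvv /=; by move/eqP: dimV => <-.
  have bv0 u : u \in [:: X; Y; Z] -> BV D V u u = 0.
    rewrite !inE => uXYZ; apply/(BV_eq0P _ _ os lc) => t _.
    rewrite -mulr2n; case/or3P: uXYZ => /eqP ->; rewrite twisted_dot_delta;
      rewrite /coord !mxE !inordK //= ?coord_delta //=; ring.
  by rewrite big_seq big1.
- exists 0, 0, 0, 0; rewrite !scale0r !addr0.
  by apply/rowP => -[[|[|[|[|[|//]]]]] hi];
    rewrite !mxE /= ?coord_delta //=; ring.
Qed.

(** The pairing of [BV] at X, Y with A is a multiple of [lambda ^+ 2 - 1]. *)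
Lemma twisted_totally_geodesic D : levi_civita D ->
  totally_geodesic D V -> lambda ^+ 2 = 1.
Proof.
move=> lc tg; have XV : X \in V by rewrite memv_span ?inE ?eqxx.
have YV : Y \in V by rewrite memv_span ?inE ?eqxx ?orbT.
have AH : A \in horizontal V.
  apply: horizontal_span => u; rewrite !inE => /or3P[] /eqP ->;
  by rewrite twisted_dot_delta coord_delta.
move/(BV_eq0P _ _ os lc): (tg X Y XV YV) => /(_ A AH).
rewrite !twisted_dot_delta /coord !mxE !inordK //= !coord_delta //= => h.
lra.
Qed.

End Example.

(** * Brackets, total geodesy and roundness *)

Theorem theorem4p1 (R : realType) (lambda : R) (lambda_gt0 : 0 < lambda) :
  (forall (G : riemLieAlgebra R) (D : {bilinear G -> G -> G}) (X Y Z A B : G),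
     adapted_basis D X Y Z A B -> su2_relations lambda X Y Z ->
     let V := <<[:: X; Y; Z]>>%VS in
     (exists r x3 x4 x5 x6 z3 z4 theta1 theta2 theta3 : R,
        (* bracket relations *)
        [/\ su2_relations lambda X Y Z,
            ⟦X, A⟧ = - (lambda ^+ 2 * x3) *: Y - (lambda ^+ 2 * x5) *: Z /\
            ⟦X, B⟧ = - (lambda ^+ 2 * x4) *: Y - (lambda ^+ 2 * x6) *: Z,
            ⟦Y, A⟧ = x3 *: X + z3 *: Z /\ ⟦Y, B⟧ = x4 *: X + z4 *: Z,
            ⟦Z, A⟧ = x5 *: X - z3 *: Y /\ ⟦Z, B⟧ = x6 *: X - z4 *: Y &
            ⟦A, B⟧ = r *: A + theta1 *: X + theta2 *: Y + theta3 *: Z]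
        /\
        [/\ theta1 = 2^-1 * (r * z3 / lambda + lambda * (x3 * x6 - x4 * x5)),
            theta2 = 2^-1 * (lambda * (r * x5 - x3 * z4 + x4 * z3)) &
            theta3 = 2^-1 * - (lambda * (r * x3 + z4 * x5 - z3 * x6))]
        /\
        (* total geodesy of an individual member of the family *)
        (totally_geodesic D V <->
           lambda = 1 \/ [/\ x3 = 0, x4 = 0, x5 = 0 & x6 = 0]))
     /\ riemannian D V
     /\ (round_leaves V <-> lambda = 1))
  /\
  (* total geodesy of the family as a whole *)
  ((forall (G : riemLieAlgebra R) (D : {bilinear G -> G -> G}) (X Y Z A B : G),
      adapted_basis D X Y Z A B -> su2_relations lambda X Y Z ->
      totally_geodesic D <<[:: X; Y; Z]>>%VS) <-> lambda = 1).
Proof.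
split=> [G D X Y Z A B frame su2 V|].
  split; last by split; [exact: (su2_riemannian lambda_gt0 frame su2)|exact: (su2_round_leaves lambda_gt0 frame su2)].
  have [r [x3 [x4 [x5 [x6 [z3 [z4 [t1 [t2 [t3 rel]]]]]]]]]] :=
    su2_brackets lambda_gt0 frame su2.
  exists r, x3, x4, x5, x6, z3, z4, t1, t2, t3.
  have [_ [XA XB] [YA YB] [ZA ZB] AB] := rel; split; first exact: rel.
  split; first exact: (theta_jacobi lambda_gt0 frame su2 XA XB YA YB ZA ZB AB).
  exact: (totally_geodesic_cases lambda_gt0 frame XA XB YA YB ZA ZB).
split=> [tg|l1 G D X Y Z A B frame su2].
  have l0 : lambda != 0 by rewrite gt_eqF.
  have [D lc] : exists D : {bilinear twisted_su2 l0 -> twisted_su2 l0 -> twisted_su2 l0},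
      levi_civita D.
    apply: levi_civita_exists (delta_orthonormal l0) _ => u.
    by have /andP[/eqP -> _] := delta_basis_of l0; rewrite memvf.
  have /twisted_totally_geodesic := tg _ _ _ _ _ _ _
    (twisted_adapted_basis lc) (twisted_su2_relations l0).
  move=> /(_ lc) /eqP; rewrite sqrf_eq1 => /orP[/eqP //|/eqP l1].
  by move: lambda_gt0; rewrite l1; lra.
have [r [x3 [x4 [x5 [x6 [z3 [z4 [t1 [t2 [t3 rel]]]]]]]]]] :=
  su2_brackets lambda_gt0 frame su2.
have [_ [XA XB] [YA YB] [ZA ZB] _] := rel.
apply/(totally_geodesic_cases lambda_gt0 frame XA XB YA YB ZA ZB).
by left.
Qed.
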